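(* Let $\mathcal{P}$ be the class of graphs defined in the context below. Every graph $G\in\mathcal{P}$ has edge chromatic number $\chi'(G)=4$.
   Context: All graphs are finite, simple and undirected. An edge $k$-coloring of $G$ is a map $f:E(G)\to\{1,\dots,k\}$ with $f(e_1)\neq f(e_2)$ whenever $e_1,e_2$ are adjacent (share an endpoint); $\chi'(G)$ is the least $k$ for which one exists. $K_5-2e$ denotes the complete graph $K_5$ with two adjacent edges removed. Configurations. Each of the following graphs has two distinguished distinct ''attachment'' vertices $x,y$ and some internal vertices: - $G_2$: internal vertices $u,v,w$; edges $uv,uw,vw,vx,wy$. - $G_4$: internal vertices $u_0,u_1,v_0,v_1,w$; edges $xu_1,u_1u_0,u_0w,wv_0,v_0v_1,v_1y,u_1v_0,u_0v_1$. - $G_8$: internal vertices $u_0,u_1,u_2,v_0,v_1$; edges $xu_2,u_2u_1,u_1u_0,u_0v_0,v_0v_1,v_1y,u_2v_0,u_0v_1$. - $H_t$ ($t\ge 1$ an integer): internal vertices $u_0,\dots,u_t,v_0,\dots,v_t$; edges $u_0v_0,u_0u_1,u_0v_1,v_0u_1,v_0v_1$ (so $\{u_0,v_0,u_1,v_1\}$ induces $K_4$ minus the edge $u_1v_1$), the edges $u_{s-1}u_s,\ v_{s-1}v_s,\ u_sv_s$ for every $2\le s\le t$, and the edges $u_tx,\ v_ty$. Pasting a configuration on a graph $F$ at distinct vertices $z_1,z_2$ means adding a disjoint copy of its internal vertices and edges among them, and identifying $x$ with $z_1$ and $y$ with $z_2$ (edges from internal vertices to $x$ resp. $y$ become edges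 to $z_1$ resp. $z_2$). The class $\mathcal{P}$ consists of all graphs obtained from $K_5-2e$ by a (possibly empty) finite sequence of the following operations applied to the current graph $F$: (i) choose a vertex $z$ of degree two in $F$ with neighbors $z_1,z_2$, delete $z$, and paste a copy of $G_2$, $G_4$ or $G_8$ at $z_1,z_2$ (with $x$ identified with $z_1$ and $y$ with $z_2$); (ii) choose an edge $z_1z_2$ of $F$, delete this edge, and paste a copy of $H_t$ for some integer $t\ge1$ at $z_1,z_2$. *)

(* Defs.v *)
From HB Require Import structures.
From mathcomp Require Import all_boot.

Set Implicit Arguments.
Unset Strict Implicit.
Unset Printing Implicit Defensive.

Record sgraph := SGraph {
  svertex :> finType;
  sedge : rel svertex;
  sg_sym : symmetric sedge;
  sg_irrefl : irreflexive sedge }.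

Notation "x -- y" := (sedge x y) (at level 30).

Definition neighbors (G : sgraph) (x : G) : {set G} := [set y | x -- y].
Definition degree (G : sgraph) (x : G) : nat := #|neighbors x|.

Definition edges (G : sgraph) : {set {set G}} :=
  [set [set p.1; p.2] | p in [pred p : G * G | p.1 -- p.2]].

Definition sgraph_iso (G H : sgraph) : Prop :=
  exists2 f : G -> H, bijective f & forall x y, (f x -- f y) = (x -- y).

Definition edge (G : sgraph) : finType := {e : {set G} | e \in edges G}.

(* The colors 1, ..., k are represented by the elements 0, ..., k - 1 of 'I_k. *)
Definition proper_edge_coloring (G : sgraph) (k : nat)
    (f : {ffun edge G -> 'I_k}) : bool :=
  [forall e1 : edge G, forall e2 : edge G,
    (e1 != e2) && (val e1 :&: val e2 != set0) ==> (f e1 != f e2)].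

Definition edge_colorable (G : sgraph) (k : nat) : bool :=
  [exists f : {ffun edge G -> 'I_k}, proper_edge_coloring f].

Lemma edge_colorable_ex (G : sgraph) : exists k, edge_colorable G k.
Proof.
exists #|edge G|; apply/existsP; exists [ffun e => enum_rank e].
apply/forallP=> e1; apply/forallP=> e2; apply/implyP=> /andP[ne12 _].
by rewrite !ffunE (inj_eq enum_rank_inj).
Qed.

Definition chromatic_index (G : sgraph) : nat := ex_minn (edge_colorable_ex G).

Section CompleteGraph.
Variable T : finType.

Definition complete_rel : rel T := fun x y => x != y.

Lemma complete_sym : symmetric complete_rel.
Proof. by move=> x y; rewrite /complete_rel eq_sym. Qed.

Lemma complete_irrefl : irreflexive complete_rel.
Proof. by move=> x; rewrite /complete_rel eqxx. Qed.

Definition complete : sgraph := SGraph complete_sym complete_irrefl.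
End CompleteGraph.

Section DeleteEdge.
Variables (F : sgraph) (z1 z2 : F).

Definition del_edge_rel : rel F :=
  fun a b => (a -- b) && ([set a; b] != [set z1; z2]).

Lemma del_edge_sym : symmetric del_edge_rel.
Proof. by move=> a b; rewrite /del_edge_rel sg_sym setUC. Qed.

Lemma del_edge_irrefl : irreflexive del_edge_rel.
Proof. by move=> a; rewrite /del_edge_rel sg_irrefl. Qed.

Definition del_edge : sgraph := SGraph del_edge_sym del_edge_irrefl.
End DeleteEdge.

Section DeleteVertex.
Variables (F : sgraph) (z : F).

Definition del_vertex_rel : rel {v : F | v != z} := fun a b => val a -- val b.

Lemma del_vertex_sym : symmetric del_vertex_rel.
Proof. by move=> a b; exact: sg_sym. Qed.

Lemma del_vertex_irrefl : irreflexive del_vertex_rel.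
Proof. by move=> a; exact: sg_irrefl. Qed.

Definition del_vertex : sgraph := SGraph del_vertex_sym del_vertex_irrefl.
End DeleteVertex.

Definition K5m2e : sgraph :=
  let o (k : nat) : 'I_5 := inord k in
  del_edge (F := del_edge (F := complete 'I_5) (o 0) (o 1)) (o 0) (o 2).

(* Names for the vertices of configurations: cX and cY are the attachment
   vertices; an unindexed u or v is cU 0 or cV 0. *)
Inductive cvertex := cX | cY | cU of nat | cV of nat | cW.

Definition cvertex_code (a : cvertex) : nat * nat :=
  match a with
  | cX => (0, 0) | cY => (1, 0) | cU i => (2, i) | cV i => (3, i) | cW => (4, 0)
  end.

Definition cvertex_decode (p : nat * nat) : cvertex :=
  match p.1 with 0 => cX | 1 => cY | 2 => cU p.2 | 3 => cV p.2 | _ => cW end.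

Lemma cvertex_codeK : cancel cvertex_code cvertex_decode.
Proof. by case. Qed.

HB.instance Definition _ := Countable.copy cvertex (can_type cvertex_codeK).

(* A configuration is given by its list of (unoriented) edges; its internal
   vertices are the endpoints of these edges other than cX and cY. *)
Definition config := seq (cvertex * cvertex).

Definition cadj (C : config) (a b : cvertex) : bool :=
  (a != b) && (((a, b) \in C) || ((b, a) \in C)).

Definition internal (C : config) : finType :=
  seq_sub [seq a <- unzip1 C ++ unzip2 C | a \notin [:: cX; cY]].

Definition G2 : config :=
  [:: (cU 0, cV 0); (cU 0, cW); (cV 0, cW); (cV 0, cX); (cW, cY)].

Definition G4 : config :=
  [:: (cX, cU 1); (cU 1, cU 0); (cU 0, cW); (cW, cV 0); (cV 0, cV 1);
      (cV 1, cY); (cU 1, cV 0); (cU 0, cV 1)].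

Definition G8 : config :=
  [:: (cX, cU 2); (cU 2, cU 1); (cU 1, cU 0); (cU 0, cV 0); (cV 0, cV 1);
      (cV 1, cY); (cU 2, cV 0); (cU 0, cV 1)].

(* [iota 2 t.-1] enumerates 2, ..., t. *)
Definition Hconf (t : nat) : config :=
  [:: (cU 0, cV 0); (cU 0, cU 1); (cU 0, cV 1); (cV 0, cU 1); (cV 0, cV 1)]
  ++ flatten [seq [:: (cU s.-1, cU s); (cV s.-1, cV s); (cU s, cV s)]
             | s <- iota 2 t.-1]
  ++ [:: (cU t, cX); (cV t, cY)].

Section Paste.
Variables (F : sgraph) (C : config) (z1 z2 : F).

Definition attached (a : F) (i : cvertex) : bool :=
  (a == z1) && cadj C cX i || (a == z2) && cadj C cY i.

Definition paste_rel : rel (F + internal C)%type := fun p q =>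
  match p, q with
  | inl a, inl b => a -- b
  | inl a, inr i => attached a (val i)
  | inr i, inl a => attached a (val i)
  | inr i, inr j => cadj C (val i) (val j)
  end.

Lemma paste_sym : symmetric paste_rel.
Proof.
case=> [a|i] [b|j] //=; first exact: sg_sym.
by rewrite /cadj eq_sym orbC.
Qed.

Lemma paste_irrefl : irreflexive paste_rel.
Proof. by case=> [a|i] /=; rewrite ?sg_irrefl // /cadj eqxx. Qed.

Definition paste : sgraph := SGraph paste_sym paste_irrefl.
End Paste.

(* Graphs are taken up to isomorphism, hence the [sgraph_iso] hypotheses. *)
Inductive classP : sgraph -> Prop :=
| classP_base (G : sgraph) : sgraph_iso G K5m2e -> classP G
| classP_vertex (F : sgraph) (z : F) (z1 z2 : del_vertex z) (C : config)
    (G : sgraph) :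
    classP F ->
    degree z = 2 ->
    neighbors z = [set val z1; val z2] ->
    [\/ C = G2, C = G4 | C = G8] ->
    sgraph_iso G (paste C z1 z2) ->
    classP G
| classP_edge (F : sgraph) (z1 z2 : F) (t : nat) (G : sgraph) :
    classP F ->
    z1 -- z2 ->
    0 < t ->
    sgraph_iso G (paste (F := del_edge z1 z2) (Hconf t) z1 z2) ->
    classP G.

(* Main.v *)
Require Import Defs.
From mathcomp Require Import all_boot fingroup perm.

Set Implicit Arguments.
Unset Strict Implicit.
Unset Printing Implicit Defensive.

(** A vertex of degree four is never deleted and keeps its degree, so
four colors are necessary. Conversely, a proper 4-edge-coloring survives both
operations. Deleting a vertex [z] of degree two frees two distinct colors, one
at each neighbor, and deleting an edge frees the same color at both its ends;
it is thus enough to color each configuration so that its two pendant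
edges carry prescribed colors, distinct for [G2], [G4], [G8] and equal for
[H_t]. Up to a permutation of the colors one such coloring suffices. *)

(* A coloring of pairs instead of edges; its values off [adj] are irrelevant. *)
Definition proper (V K : Type) (adj : rel V) (c : V -> V -> K) : Prop :=
  (forall x y, c x y = c y x) /\
  (forall x y z, adj x y -> adj x z -> c x y = c x z -> y = z).

(** * Chromatic index from colorings of pairs and from degrees *)

Section ChromaticIndex.
Variable G : sgraph.

Lemma proper_edge_colorable (k : nat) (c : G -> G -> 'I_k) :
  proper (@sedge G) c -> edge_colorable G k.
Proof.
case=> cC cI.
have edgeP (e : edge G) :
    exists p : G * G, (p.1 -- p.2) && (val e == [set p.1; p.2]).
  by case: e => e /= /imsetP[p]; rewrite inE => ep ->; exists p; rewrite ep /=.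
(* An edge is only a set, so an ordered pair of its endpoints is chosen; symmetry of [c] makes the
   color independent of the choice. *)
apply/existsP; exists [ffun e => let p := xchoose (edgeP e) in c p.1 p.2].
apply/forallP=> e1; apply/forallP=> e2; apply/implyP=> /andP[ne /set0Pn[x]].
rewrite !ffunE.
case/andP: (xchooseP (edgeP e1)) => + /eqP def1.
case/andP: (xchooseP (edgeP e2)) => + /eqP def2.
move: (xchoose _) def1 => [a b] /= def1; move: (xchoose _) def2 => [a' b'] /= def2.
move=> e2P e1P; rewrite inE => /andP[x1 x2]; apply: contra ne => /eqP cE.
have orient (e : {set G}) u v : u -- v -> e = [set u; v] -> x \in e ->
    exists y, [/\ x -- y, e = [set x; y] & c u v = c x y].
  move=> uv ->; rewrite !inE => /orP[]/eqP->; first by exists v.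
  by exists u; rewrite sg_sym setUC cC.
have [y1 [xy1 E1 c1]] := orient _ _ _ e1P def1 x1.
have [y2 [xy2 E2 c2]] := orient _ _ _ e2P def2 x2.
apply/eqP/val_inj; rewrite /= E1 E2; congr [set x; _].
by apply: cI xy1 xy2 _; rewrite -c1 -c2.
Qed.

(** Edges meeting at [x] have pairwise distinct colors, so coloring the edge from [x] to [y] injects
    the neighbors of [x] into the colors. *)
Lemma degree_edge_colorable (k : nat) (x : G) :
  edge_colorable G k -> degree x <= k.
Proof.
case/existsP=> f /forallP fP.
have eP (y : G) : x -- y -> [set x; y] \in edges G.
  by move=> xy; apply/imsetP; exists (x, y).
pose h (y : {y : G | x -- y}) : 'I_k := f (Sub [set x; val y] (eP _ (valP y))).
suff /leq_card : injective h.
  rewrite card_ord card_sig; apply: leq_trans.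
  by rewrite /degree subset_leq_card //; apply/subsetP=> y; rewrite !inE.
move=> y1 y2 /eqP hE; apply/eqP/contraT => ne.
have /forallP/(_ (Sub [set x; val y2] (eP _ (valP y2)))) :=
  fP (Sub [set x; val y1] (eP _ (valP y1))).
rewrite (negPf (_ : ~~ (f _ != f _))) ?negbK // implybF negb_and negbK.
case/orP=> [/eqP/(congr1 val)/= /setP E|].
  have := E (val y1); rewrite !inE eqxx orbT => /esym/orP[]/eqP y1E.
    by have := valP y1; rewrite y1E sg_irrefl.
  by rewrite (val_inj y1E) eqxx in ne.
by move/negP; case; apply/set0Pn; exists x; rewrite !inE eqxx.
Qed.

Lemma chromatic_index_eq (k : nat) (c : G -> G -> 'I_k) (x : G) :
  proper (@sedge G) c -> k <= degree x -> chromatic_index G = k.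
Proof.
move=> /proper_edge_colorable ck kx; rewrite /chromatic_index.
case: ex_minnP => m /(degree_edge_colorable x)/(leq_trans kx) km /(_ k ck) mk.
by apply/eqP; rewrite eqn_leq mk.
Qed.

End ChromaticIndex.

(** The induction invariant: a coloring bounds the chromatic index above by four, a vertex of degree
    at least four bounds it below. *)
Definition tight (G : sgraph) : Prop :=
  (exists c : G -> G -> 'I_4, proper (@sedge G) c) /\
  (exists x : G, 4 <= degree x).

Lemma tight_iso (G H : sgraph) : sgraph_iso G H -> tight H -> tight G.
Proof.
case=> f [g fK gK] fE [[c [cC cI]] [y y4]]; split.
  exists (fun a b => c (f a) (f b)); split=> [a b|a b b'] //.
  by rewrite -!fE => ab ab' /(cI _ _ _ ab ab')/(can_inj fK).
exists (g y); rewrite (leq_trans y4) // /degree -(card_imset _ (can_inj gK)).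
apply/subset_leq_card/subsetP=> a /imsetP[b + ->].
by rewrite !inE -fE !gK.
Qed.

(** * Colorings and degrees under pasting *)

Section Paste.
Variables (C : config) (F : sgraph) (z1 z2 : F).
Hypothesis z12 : z1 != z2.

Lemma paste_proper (K : Type) (c : F -> F -> K) (cc : cvertex -> cvertex -> K) :
    proper (@sedge F) c -> proper (cadj C) cc ->
    (forall a i, z1 -- a -> cadj C cX i -> c z1 a <> cc cX i) ->
    (forall a i, z2 -- a -> cadj C cY i -> c z2 a <> cc cY i) ->
  exists c' : paste C z1 z2 -> paste C z1 z2 -> K,
    proper (@sedge (paste C z1 z2)) c'.
Proof.
move=> [cC cI] [ccC ccI] free1 free2.
(* [phi] folds the pasted graph onto the configuration. Old vertices other than [z1] also go to
   [cY], harmlessly: only [z1] and [z2] meet internal vertices. *)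
pose phi (p : F + internal C) : cvertex :=
  match p with inl a => if a == z1 then cX else cY | inr i => val i end.
pose c' (p q : F + internal C) : K :=
  match p, q with inl a, inl b => c a b | _, _ => cc (phi p) (phi q) end.
have attE a i : attached C z1 z2 a i ->
    cadj C (phi (inl a)) i /\ (a = z1 \/ a = z2).
  rewrite /attached /=; case: eqVneq => [->|_] /=.
    by rewrite (negPf z12) orbF; split; [|left].
  by case/andP=> /eqP->; split; [|right].
have internalP (i : internal C) : val i \notin [:: cX; cY].
  by have := valP i; rewrite mem_filter => /andP[].
have phi_internal a (i : internal C) : phi (inl a) <> val i.
  move=> E; have := internalP i; rewrite -E /=.
  by case: ifP => _; rewrite !inE eqxx ?orbT.
have cadjC a b : cadj C a b = cadj C b a by rewrite /cadj eq_sym orbC.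
have adj_inr (i : internal C) p : paste_rel z1 z2 (inr i) p ->
    cadj C (val i) (phi p).
  by case: p => [a|j] //= /attE[]; rewrite cadjC.
(* Injectivity of [phi] on the neighborhood of an internal vertex lets properness of [cc] lift to
   that vertex. *)
have phi_inj (i : internal C) p q : paste_rel z1 z2 (inr i) p ->
    paste_rel z1 z2 (inr i) q -> phi p = phi q -> p = q.
  case: p q => [a|j] [b|l] //=; last by move=> _ _ /val_inj->.
  - move=> /attE[_ aE] /attE[_ bE].
    by case: aE bE => -> [] ->; rewrite ?eqxx ?[z2 == z1]eq_sym ?(negPf z12).
  - by move=> _ _ /phi_internal.
  - by move=> _ _ /esym/phi_internal.
(* An old edge and a new one can only meet at [z1] or [z2], where [free1] and [free2] separate their
   colors. *)
have mixed a b (i : internal C) : a -- b -> attached C z1 z2 a (val i) ->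
    c a b <> cc (phi (inl a)) (val i).
  move=> ab /attE[]; rewrite /phi => adj aE; case: aE ab adj => ->.
    by rewrite eqxx; apply: free1.
  by rewrite eq_sym (negPf z12); apply: free2.
exists c'; split.
  by case=> [a|i] [b|j] /=.
case=> [a|i] p q.
  case: p q => [b|i] [b'|j] //=.
  - by move=> ab ab' /(cI _ _ _ ab ab')->.
  - by move=> ab aj /(mixed _ _ _ ab aj).
  - by move=> ai ab /esym/(mixed _ _ _ ab ai).
  - by move=> /attE[ai _] /attE[aj _] /(ccI _ _ _ ai aj)/val_inj->.
move=> ip iq E; apply: (phi_inj i) => //.
by apply: ccI (adj_inr _ _ ip) (adj_inr _ _ iq) _; case: p q ip iq E => [?|?] [].
Qed.

(** Each attachment vertex gains at least one internal neighbor, which makes up for the edge it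
    loses in the deletion before pasting. *)
Lemma paste_degree (i1 i2 : internal C) (a : F) :
  cadj C cX (val i1) -> cadj C cY (val i2) ->
  degree a + (a == z1) + (a == z2) <= degree (inl a : paste C z1 z2).
Proof.
move=> X1 Y2.
have sumE (A : {set F}) (i : internal C) :
    #|(inr i : F + internal C) |: inl @: A| = #|A|.+1.
  rewrite cardsU1 card_imset; last by move=> ? ? [].
  by case: imsetP => [[]|] //.
have sub (i : internal C) : attached C z1 z2 a (val i) ->
    degree a + 1 <= degree (inl a : paste C z1 z2).
  move=> ai; rewrite addn1 -(sumE _ i); apply/subset_leq_card/subsetP=> p.
  rewrite !inE => /orP[/eqP->//|/imsetP[b + ->]].
  by rewrite inE.
have [az1|_] := eqVneq a z1.
  rewrite {2}az1 (negPf z12) addn0; apply: (sub i1).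
  by rewrite /attached az1 eqxx X1.
have [az2|_] := eqVneq a z2.
  rewrite addn0; apply: (sub i2).
  by rewrite /attached az2 eqxx Y2 orbT.
rewrite !addn0 /degree -(card_imset (neighbors a) (_ : injective (@inl F (internal C)))).
  by apply/subset_leq_card/subsetP=> p /imsetP[b + ->]; rewrite !inE.
by move=> ? ? [].
Qed.

End Paste.

(** * Configurations with prescribed pendant colors *)

Definition pluggable (C : config) (alpha beta : 'I_4) : Prop :=
  [/\ exists cc : cvertex -> cvertex -> 'I_4,
        [/\ proper (cadj C) cc,
            forall i, cadj C cX i -> cc cX i = alpha
          & forall i, cadj C cY i -> cc cY i = beta],
      exists i : internal C, cadj C cX (val i)
    & exists i : internal C, cadj C cY (val i)].

Lemma pluggable_perm (C : config) (alpha beta : 'I_4) (s : {perm 'I_4}) :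
  pluggable C alpha beta -> pluggable C (s alpha) (s beta).
Proof.
case=> [[cc [[ccC ccI] ccX ccY]] iX iY]; split=> //.
exists (fun a b => s (cc a b)); split=> [|i /ccX->|i /ccY->] //; split.
  by move=> a b; rewrite ccC.
by move=> a b b' ab ab' /perm_inj; apply: ccI.
Qed.

(** Here [F] is the graph after deletion, so [x] may have degree three in it; the last two clauses
    of [pluggable] restore the missing edge at [z1] or [z2]. *)
Lemma tight_paste (C : config) (F : sgraph) (z1 z2 : F) (alpha beta : 'I_4)
    (c : F -> F -> 'I_4) (x : F) :
    z1 != z2 -> pluggable C alpha beta -> proper (@sedge F) c ->
    (forall a, z1 -- a -> c z1 a <> alpha) ->
    (forall a, z2 -- a -> c z2 a <> beta) ->
    4 <= degree x + (x == z1) + (x == z2) ->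
  tight (paste C z1 z2).
Proof.
move=> z12 [[cc [ccP ccX ccY]] [i1 X1] [i2 Y2]] cP free1 free2 x4; split.
  apply: paste_proper cP ccP _ _ => // a i.
    by move=> /free1 + /ccX->.
  by move=> /free2 + /ccY->.
by exists (inl x); apply: leq_trans x4 (paste_degree z12 _ X1 Y2).
Qed.

Lemma internal_ex (C : config) (a b : cvertex) :
  a \in [:: cX; cY] -> b \notin [:: cX; cY] -> (a, b) \in C \/ (b, a) \in C ->
  exists i : internal C, cadj C a (val i).
Proof.
move=> aXY bXY abC.
have bP : b \in [seq a <- unzip1 C ++ unzip2 C | a \notin [:: cX; cY]].
  rewrite mem_filter bXY mem_cat /=.
  by case: abC => [/(map_f snd)|/(map_f fst)] /= ->; rewrite ?orbT.
exists (SeqSub bP); rewrite /cadj /=.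
have -> /= : a != b by apply: contraNneq bXY => <-.
by case: abC => ->; rewrite ?orbT.
Qed.

Lemma map_uniq_inj (T K : eqType) (f : T -> K) (s : seq T) :
  uniq (map f s) -> {in s &, injective f}.
Proof.
elim: s => //= x s IH /andP[xs us] a b; rewrite !inE.
case/predU1P=> [->|sa] /predU1P[->|sb] // E; last exact: IH.
  by case/negP: xs; rewrite E map_f.
by case/negP: xs; rewrite -E map_f.
Qed.

Section ListColoring.
Variables (C : config) (ks : seq 'I_4).

(* [ks] lists the colors of the edges of [C] in order. *)
Definition list_color (a b : cvertex) : 'I_4 :=
  nth ord0 ks (find [pred e | (e == (a, b)) || (e == (b, a))] C).

Definition cneighbors (a : cvertex) : seq cvertex :=
  [seq e.2 | e <- C & e.1 == a] ++ [seq e.1 | e <- C & e.2 == a].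

(** A computable sufficient test for [pluggable]. Distinct colors along [cneighbors a] give
    properness at [a]; the tests against [cX] and [cY] make the pendant neighbors internal. *)
Definition pluggable_check (alpha beta : 'I_4) : bool :=
  [&& all (fun a => uniq (map (list_color a) (cneighbors a)))
        (unzip1 C ++ unzip2 C),
      all (fun b => (list_color cX b == alpha) && (b \notin [:: cX; cY]))
        (cneighbors cX),
      all (fun b => (list_color cY b == beta) && (b \notin [:: cX; cY]))
        (cneighbors cY),
      cneighbors cX != [::] & cneighbors cY != [::]].

Lemma mem_cneighbors (a b : cvertex) :
  (b \in cneighbors a) = ((a, b) \in C) || ((b, a) \in C).
Proof.
rewrite mem_cat; congr (_ || _); apply/mapP/idP.
- by case=> -[a' b']; rewrite mem_filter /= => /andP[/eqP-> abC ->].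
- by move=> abC; exists (a, b); rewrite // mem_filter eqxx.
- by case=> -[a' b']; rewrite mem_filter /= => /andP[/eqP-> abC ->].
- by move=> abC; exists (b, a); rewrite // mem_filter eqxx.
Qed.

Lemma pluggable_checkP (alpha beta : 'I_4) :
  pluggable_check alpha beta -> pluggable C alpha beta.
Proof.
case/and5P=> /allP uniqC /allP colX /allP colY neX neY.
have adjP a b : cadj C a b -> b \in cneighbors a.
  by rewrite mem_cneighbors => /andP[].
have exP a (col : 'I_4) : a \in [:: cX; cY] -> cneighbors a != [::] ->
    (forall b, b \in cneighbors a ->
      (list_color a b == col) && (b \notin [:: cX; cY])) ->
    exists i : internal C, cadj C a (val i).
  move=> aXY; case def: (cneighbors a) => [//|b l] _ /(_ b (mem_head _ _)).
  case/andP=> _ bXY; apply: internal_ex aXY bXY _; apply/orP.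
  by rewrite -mem_cneighbors def mem_head.
split; [|exact: exP neX colX|exact: exP neY colY].
exists list_color; split; last 2 first.
- by move=> i /adjP/colX/andP[/eqP].
- by move=> i /adjP/colY/andP[/eqP].
split=> [a b|a b b' /adjP ab /adjP ab' cE].
  by rewrite /list_color; congr nth; apply: eq_find => e; rewrite /= orbC.
have aC : a \in unzip1 C ++ unzip2 C.
  move: ab; rewrite mem_cneighbors mem_cat.
  by case/orP=> [/(map_f fst)|/(map_f snd)] /= ->; rewrite ?orbT.
exact: map_uniq_inj (uniqC a aC) _ _ ab ab' cE.
Qed.

End ListColoring.

Local Notation color k := (@Ordinal 4 k isT).

Lemma pluggable_neq (C : config) (alpha beta : 'I_4) :
  [\/ C = G2, C = G4 | C = G8] -> alpha != beta -> pluggable C alpha beta.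
Proof.
move=> CE ne.
have plug01 : pluggable C (color 0) (color 1).
  case: CE => ->; [ pose ks := [:: color 1; color 0; color 2; color 0; color 1]
    | pose ks := [:: color 0; color 1; color 2; color 0; color 2; color 1;
                     color 3; color 0]
    | pose ks := [:: color 0; color 1; color 0; color 1; color 0; color 1;
                     color 2; color 2] ];
  by apply: (@pluggable_checkP _ ks); vm_compute.
(* [p] sends 0 to [alpha]; the second transposition sends [p 1] to [beta] and fixes [alpha], which
   differs from both. *)
pose p := tperm (color 0) alpha; pose s := (p * tperm (p (color 1)) beta)%g.
have p0 : p (color 0) = alpha by rewrite tpermL.
have s0 : s (color 0) = alpha.
  rewrite permM p0 tpermD // 1?eq_sym //.
  by rewrite -p0 (inj_eq perm_inj).
have s1 : s (color 1) = beta by rewrite permM tpermL.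
by rewrite -s0 -s1; apply: pluggable_perm.
Qed.

(** * The ladder configurations *)

Section Ladder.
Variable t : nat.
Hypothesis t_gt0 : 0 < t.

(* The color of the edges leaving [cU s] and [cV s] towards the attachment
   vertices; it is 0 for the two pendant edges, where [s = t]. *)
Definition rail (s : nat) : 'I_4 := if odd (t + s) then color 1 else color 0.

(** The 4-cycle on [u0, u1, v0, v1] alternates 2 and 3, rungs get 2, and both rails alternate 0 and
    1 in parallel, so the pendant edges agree. The chord [u0 v0] sees only 2 and 3 and takes a rail
    color. *)
Definition Hcolor (a b : cvertex) : 'I_4 :=
  match a, b with
  | cU 0, cV 0 | cV 0, cU 0 => rail 1
  | cU i, cU j | cV i, cV j =>
      if minn i j == 0 then color 2 else rail (minn i j)
  | cU i, cV j | cV i, cU j => if i == j then color 2 else color 3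
  | _, _ => color 0
  end.

Definition Hneighbors (a : cvertex) : seq cvertex :=
  match a with
  | cX => [:: cU t]
  | cY => [:: cV t]
  | cW => [::]
  | cU 0 => [:: cV 0; cU 1; cV 1]
  | cV 0 => [:: cU 0; cU 1; cV 1]
  | cU 1 => [:: cU 0; cV 0; if t == 1 then cX else cU 2]
  | cV 1 => [:: cU 0; cV 0; if t == 1 then cY else cV 2]
  | cU s => [:: cU s.-1; cV s; if t == s then cX else cU s.+1]
  | cV s => [:: cV s.-1; cU s; if t == s then cY else cV s.+1]
  end.

(** One inclusion is enough: distinct colors along a list containing all neighbors already give
    properness. *)
Lemma Hconf_neighbors (a b : cvertex) :
  (a, b) \in Hconf t -> (b \in Hneighbors a) && (a \in Hneighbors b).
Proof.
rewrite !mem_cat => /or3P[||].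
- by rewrite !inE => /or4P[||| /orP[]] /eqP[-> ->]; rewrite !inE ?eqxx ?orbT.
- case/flattenP=> l /mapP[s]; rewrite mem_iota => /andP[s2 st] ->.
  (* Membership in [iota 2 t.-1] gives [s < 2 + t.-1], which is [s <= t] because [t] is positive. *)
  have {}st : s <= t by case: t t_gt0 st => // t'; rewrite /= add2n.
  case: s s2 st => [|[|s]] // _ st; rewrite !inE => /or3P[]/eqP[-> ->] /=.
  + by case: s st => [|s] st /=; rewrite !inE ?(gtn_eqF st) !eqxx ?orbT.
  + by case: s st => [|s] st /=; rewrite !inE ?(gtn_eqF st) !eqxx ?orbT.
  + by rewrite !inE !eqxx ?orbT.
- rewrite !inE => /orP[]/eqP[-> ->]; case def: t t_gt0 => [|[|s]] //= _;
  by rewrite !inE def ?eqxx ?orbT.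
Qed.

Lemma Hcolor_uniq (a : cvertex) : uniq (map (Hcolor a) (Hneighbors a)).
Proof.
have minSn n : minn n.+1 n = n by apply/minn_idPr.
have minnS n : minn n n.+1 = n by apply/minn_idPl.
have simp := (in_cons, eqxx, minSn, minnS).
case: a => [||[|[|s]]|[|[|s]]|] //=;
  (* What remains are the levels from 1 up. On levels from 2 up, the lower rail has color 1 against
     the pendant 0 when the level is [t]; otherwise consecutive rails differ by parity. *)
  try (by rewrite /rail; case: odd);
  case: (eqVneq t _) => [tE|_];
  rewrite /= ?simp /rail ?tE ?addSn ?addnS ?addnn /= ?odd_double //=; by case: odd.
Qed.

Lemma Hcolor_proper : proper (cadj (Hconf t)) Hcolor.
Proof.
split.
  by case=> [||[|i]|[|i]|] [||[|j]|[|j]|] //=; rewrite ?[minn i.+1 _]minnC 1?eq_sym.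
have adjP a b : cadj (Hconf t) a b -> b \in Hneighbors a.
  by case/andP=> _ /orP[]/Hconf_neighbors/andP[].
by move=> a b b' /adjP ab /adjP ab'; apply: map_uniq_inj (Hcolor_uniq a) _ _ ab ab'.
Qed.

Lemma pluggable_Hconf (alpha : 'I_4) : pluggable (Hconf t) alpha alpha.
Proof.
rewrite -(tpermL (color 0) alpha); apply: pluggable_perm.
split; first by exists Hcolor; split=> //; apply: Hcolor_proper.
- apply: (@internal_ex _ cX (cU t)) => //; right.
  by rewrite !mem_cat !inE eqxx ?orbT.
- apply: (@internal_ex _ cY (cV t)) => //; right.
  by rewrite !mem_cat !inE eqxx ?orbT.
Qed.

End Ladder.

(** * The base graph and the two operations *)

Lemma tight_K5m2e : tight K5m2e.
Proof.
pose k5adj (i j : nat) :=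
  (i != j) && ((i, j) \notin [:: (0, 1); (1, 0); (0, 2); (2, 0)]).
have adjP (i j : K5m2e) : i -- j -> k5adj (i : 'I_5) (j : 'I_5).
  case/andP=> /andP[/= ij n01] n02; apply/andP; split=> //.
  apply: contraL n02; rewrite negbK => ijE; apply: contraLR n01 => n02.
  rewrite negbK; move: ijE n02.
  have ordE (k : 'I_5) m : val k == m -> k = inord m.
    by move/eqP<-; rewrite inord_val.
  rewrite !inE => /or4P[]/eqP[/eqP/ordE-> /eqP/ordE->];
  by rewrite ?eqxx // setUC eqxx.
(* The eight edges split into four matchings of two consecutive entries, one per color. *)
pose E := [:: (0, 3); (1, 4); (0, 4); (2, 3); (3, 4); (1, 2); (1, 3); (2, 4)].
pose c (i j : nat) :=
  nth ord0 [:: color 0; color 0; color 1; color 1; color 2; color 2; color 3; color 3]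
    (find [pred e | (e == (i, j)) || (e == (j, i))] E).
split.
  exists (fun i j : 'I_5 => c i j); split=> [i j|i j k /adjP + /adjP + cE].
    by rewrite /c; congr nth; apply: eq_find => e; rewrite /= orbC.
  move=> ij ik; apply: val_inj; move: ij ik cE.
  by case: i j k => [[|[|[|[|[|//]]]]] ?] [[|[|[|[|[|//]]]]] ?] [[|[|[|[|[|//]]]]] ?].
(* Vertex 3 lies on neither removed edge, so it keeps degree four. *)
exists (inord 3 : 'I_5); rewrite /degree.
apply: (@leq_trans #|[set~ inord 3 : 'I_5]|).
  by rewrite cardsC1 card_ord.
apply/subset_leq_card/subsetP=> i; rewrite !inE eq_sym /= /del_edge_rel /= => ne.
have neq k : k < 3 -> [set inord 3; i] != [set inord 0; inord k] :> {set 'I_5}.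
  move=> k3; have k5 : k < 5 by apply: ltn_trans k3 _.
  apply/eqP=> /setP/(_ (inord 3)); rewrite !inE eqxx /=.
  by rewrite -!val_eqE /= !inordK // (gtn_eqF k3).
by rewrite /del_edge_rel /= /complete_rel ne !neq.
Qed.

Lemma tight_vertex (F : sgraph) (z : F) (z1 z2 : del_vertex z) (C : config) :
  tight F -> degree z = 2 -> neighbors z = [set val z1; val z2] ->
  [\/ C = G2, C = G4 | C = G8] -> tight (paste C z1 z2).
Proof.
move=> [[c [cC cI]] [x x4]] dz Nz CE.
have z12 : z1 != z2.
  apply: contra_eqN dz => /eqP z12.
  by rewrite /degree Nz z12 setUid cards1.
have zz1 : val z1 -- z.
  by have : val z1 \in neighbors z; [rewrite Nz set21|rewrite inE sg_sym].
have zz2 : val z2 -- z.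
  by have : val z2 \in neighbors z; [rewrite Nz set22|rewrite inE sg_sym].
have xz : x != z by apply: contraTneq x4 => ->; rewrite dz.
pose x' : del_vertex z := Sub x xz.
have freeP (y a : del_vertex z) : val y -- z -> y -- a ->
    c (val y) (val a) <> c (val y) z.
  by move=> yz ya /(cI _ _ _ ya yz) E; have := valP a; rewrite E eqxx.
apply: (@tight_paste C (del_vertex z) z1 z2 (c (val z1) z) (c (val z2) z)
          (fun a b => c (val a) (val b)) x' z12).
(* The two freed colors differ because both deleted edges meet at [z]. *)
- apply: pluggable_neq CE _; apply: contra_neqN z12 => /eqP E.
  by apply/val_inj; apply: (cI z); rewrite ?[z -- _]sg_sym // cC E cC.
- by split=> [a b|a b b' ab ab' /(cI _ _ _ ab ab')/val_inj].
- by move=> a; apply: freeP.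
- by move=> a; apply: freeP.
apply: leq_trans x4 _; rewrite /degree (cardsD1 z) inE.
(* The degree of [x] drops by one exactly when [x] is [z1] or [z2], as these are the neighbors of
   [z]. *)
have -> : (x -- z : nat) = (x' == z1) + (x' == z2).
  have -> : x -- z = (x' == z1) || (x' == z2).
    have : (x \in neighbors z) = (x -- z) by rewrite inE sg_sym.
    by rewrite Nz !inE => <-.
  by case: eqVneq => [->|//]; rewrite (negPf z12).
rewrite addnC -addnA leq_add2r -(card_imset (neighbors x') val_inj).
apply/subset_leq_card/subsetP=> a; rewrite !inE => /andP[az xa].
by apply/imsetP; exists (Sub a az : del_vertex z); rewrite ?inE.
Qed.

Lemma tight_edge (F : sgraph) (z1 z2 : F) (t : nat) :
  tight F -> z1 -- z2 -> 0 < t ->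
  tight (paste (F := del_edge z1 z2) (Hconf t) z1 z2).
Proof.
move=> [[c [cC cI]] [x x4]] e12 t_gt0.
have z12 : z1 != z2 by apply: contraTneq e12 => ->; rewrite sg_irrefl.
apply: (@tight_paste _ (del_edge z1 z2) _ _ (c z1 z2) (c z1 z2) c x z12).
- exact: pluggable_Hconf.
- by split=> // a b b' /andP[ab _] /andP[ab' _]; apply: cI.
- by move=> a /andP[za +] /(cI _ _ _ za e12) E; rewrite E eqxx.
- have e21 : z2 -- z1 by rewrite sg_sym.
  move=> a /andP[za +]; rewrite [c z1 z2]cC => + /(cI _ _ _ za e21) E.
  by rewrite E setUC eqxx.
apply: leq_trans x4 _.
(* With [w] the other end of the deleted edge, an end [x] loses only the neighbor [w]. *)
have sub (w : F) : {subset neighbors x :\ w <= neighbors (x : del_edge z1 z2)} ->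
    degree x <= degree (x : del_edge z1 z2) + 1.
  move=> /subsetP/subset_leq_card le; rewrite {1}/degree (cardsD1 w) addnC.
  by rewrite leq_add // leq_b1.
have [xz1|xz1] := eqVneq x z1.
  rewrite -addnA (leq_trans (sub z2 _)) ?leq_add ?leq_addr // => a.
  rewrite !inE /= /del_edge_rel xz1 => /andP[az2 ->] /=.
  apply: contra az2 => /eqP/setP/(_ z2); rewrite !inE eqxx orbT eq_sym.
  by rewrite [z2 == a]eq_sym (negPf z12).
have [xz2|xz2] := eqVneq x z2.
  rewrite addn0 (leq_trans (sub z1 _)) // => a.
  rewrite !inE /= /del_edge_rel xz2 => /andP[az1 ->] /=.
  apply: contra az1 => /eqP/setP/(_ z1); rewrite !inE eqxx (negPf z12) /=.
  by rewrite eq_sym.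
rewrite !addn0; apply/subset_leq_card/subsetP=> a.
rewrite !inE /= /del_edge_rel => -> /=.
apply/eqP=> /setP/(_ x); rewrite !inE eqxx (negPf xz1) (negPf xz2) //.
Qed.

Theorem theorem2 (G : sgraph) (hG : classP G) : chromatic_index G = 4.
Proof.
suff [[c cP] [x x4]] : tight G by apply: chromatic_index_eq cP x4.
elim: hG => {G} [G iso|F z z1 z2 C G _ tF dz Nz CE iso|F z1 z2 t G _ tF z12 t0 iso].
- exact: tight_iso iso tight_K5m2e.
- exact: tight_iso iso (tight_vertex tF dz Nz CE).
- exact: tight_iso iso (tight_edge tF z12 t0).
Qed.
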